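(* Let $H$ be a bipartite graph on the three left pair types and three right pair types of twelve coordinates (see context), put $h=|E(H)|$, and let $D_H$ be the bipartite graph with two copies $a^-,a^+$ of every edge $a$ of $H$, in which $a^-$ is joined to $b^+$ exactly when $a\ne b$ share an endpoint in $H$. Let $\nu(D_H)$ be the matching number of $D_H$. The maximum number of compatible transverse $2+2$ source blocks under the type restriction $H$ is $$\beta(H)=8h-4\nu(D_H)=\max_{M\text{ matching in }H}\bigl(8|M|+4|E(H-V(M))|\bigr),$$ where $V(M)$ is the set of endpoints of $M$. Consequently the maximum complete-sign transferred code under the restriction $H$ has $16\beta(H)$ vectors. Fix a maximum matching $N$ in $D_H$. For a compatible family of allowed source blocks, let $c_a$ be the number of its source blocks of type $a\in E(H)$. The family is optimal (i.e. has $\beta(H)$ blocks) if and only if $$c_a+c_b=8\quad\text{for every edge }a^-b^+\in N,\qquad c_a=8\quad\text{if either copy of }a\text{ is unmatched by }N.$$ In particular, an optimum can always be chosen with every $c_a$ equal to zero, four or eight.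
   Context: Let $L,R$ be disjoint sets of six coordinates, each partitioned into three prescribed coordinate pairs. A left pair type is a choice of two of the three left pairs; a right pair type is a choice of two of the three right pairs (three types on each side). $H$ is a bipartite graph with these two three-element vertex classes; its edges are the allowed combinations of a left and a right type. A transverse $2+2$ source block is a four-element set consisting of two coordinates of $L$ from different left pairs and two coordinates of $R$ from different right pairs; its type is the (left type, right type) pair given by the four pairs it meets. There are sixteen blocks of each type. A block is allowed if its type is an edge of $H$. A family of source blocks is compatible if any two distinct blocks intersect in at most two coordinates (equivalently, for each fixed left edge the right edges occurring with it in the family are pairwise disjoint, and symmetrically). The complete-sign transferred code of a family is obtained by taking, on each block, all sixteen vectors with $\pm1$ entries on the block and $0$ elsewhere, and applying the matrix $\begin{pmatrix}1&1\\1&-1\end{pmatrix}$ to the two coordinates of each of the six coordinate pairs; it is required that distinct vectors of the code have inner product at most $4$. $H-V(M)$ is the graph obtained by deleting the vertices in $V(M)$. *)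

(* Defs.v *)
From HB Require Import structures.
From mathcomp Require Import all_boot all_order all_algebra.
From mathcomp Require Import finmap.

Set Implicit Arguments.
Unset Strict Implicit.
Unset Printing Implicit Defensive.

Import Order.TTheory GRing.Theory Num.Theory.

(* A bipartite graph with vertex classes A and B is given by its edge set
   E : {set A * B}. *)
Section BipartiteGraphs.

Variables A B : finType.
Implicit Types (E M : {set A * B}) (e f : A * B).

Definition share_endpoint e f : bool := (e.1 == f.1) || (e.2 == f.2).

Definition is_matching E M : bool :=
  (M \subset E) &&
  [forall e in M, forall f in M, (e != f) ==> ~~ share_endpoint e f].

Definition matching_number E : nat := \max_(M | is_matching E M) #|M|.

(* V(M), split along the two vertex classes. *)
Definition left_ends M : {set A} := [set e.1 | e in M].
Definition right_ends M : {set B} := [set e.2 | e in M].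

(* E(H - V(M)) *)
Definition delete_ends E M : {set A * B} :=
  [set e in E | (e.1 \notin left_ends M) && (e.2 \notin right_ends M)].

End BipartiteGraphs.

(* (b, p, i) is the i-th member of the p-th coordinate pair on
   side b, where b = false is the side L and b = true is the side R. *)
Definition coordinate : finType := (bool * 'I_3 * 'I_2)%type.

Definition side (b : bool) : {set coordinate} :=
  [set x : coordinate | x.1.1 == b].

(* A choice of two of the three coordinate pairs of one side. *)
Definition pair_type : finType := {S : {set 'I_3} | #|S| == 2}.

(* Left types come first: H : {set edge} is a bipartite graph with the left
   types and the right types as vertex classes. *)
Definition edge : finType := (pair_type * pair_type)%type.

(* a^- is joined to b^+ iff (a, b) is in D H.  The vertex classes are taken to
   be the whole type edge instead of two copies of E(H): this only adds
   isolated vertices. *)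
Definition D (H : {set edge}) : {set edge * edge} :=
  [set ab : edge * edge | [&& ab.1 \in H, ab.2 \in H, ab.1 != ab.2
                            & share_endpoint ab.1 ab.2]].

Definition pairs_met (b : bool) (X : {set coordinate}) : {set 'I_3} :=
  [set p | [exists i : 'I_2, (b, p, i) \in X]].

(* Two coordinates on each side, meeting two different pairs of that side. *)
Definition source_block (X : {set coordinate}) : bool :=
  [forall b : bool, (#|X :&: side b| == 2) && (#|pairs_met b X| == 2)].

Definition block_of_type (a : edge) (X : {set coordinate}) : bool :=
  [&& source_block X, pairs_met false X == val a.1
    & pairs_met true X == val a.2].

Definition allowed_family (H : {set edge}) (F : {set {set coordinate}}) :
  bool :=
  [forall X in F, exists a in H, block_of_type a X].

Definition compatible (F : {set {set coordinate}}) : bool :=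
  [forall X in F, forall Y in F, (X != Y) ==> (#|X :&: Y| <= 2)].

Definition type_count (F : {set {set coordinate}}) (a : edge) : nat :=
  #|[set X in F | block_of_type a X]|.

Definition beta (H : {set edge}) : nat :=
  \max_(F : {set {set coordinate}} | allowed_family H F && compatible F) #|F|.

(* All the vectors at hand have integer entries, so Z^12 is used for R^12. *)
Definition vec : choiceType := {ffun coordinate -> int}.

Definition dot (v w : vec) : int := (\sum_(x : coordinate) v x * w x)%R.

(* Signs s x with x outside X are irrelevant. *)
Definition signed_vec (X : {set coordinate}) (s : {ffun coordinate -> bool}) :
  vec :=
  [ffun x => if x \in X then ((-1) ^+ s x)%R else 0%R].

(* The matrix with rows (1, 1) and (1, -1). *)
Definition hadamard2 : 'M[int]_2 :=
  \matrix_(i < 2, j < 2)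
     (if (i == 1%N :> nat) && (j == 1%N :> nat) then -1 else 1)%R.

Definition transfer (v : vec) : vec :=
  [ffun x : coordinate => (\sum_(j < 2) hadamard2 x.2 j * v (x.1, j))%R].

Definition transferred_code (F : {set {set coordinate}}) : {fset vec} :=
  [fset transfer (signed_vec X s)
     | X in F, s in {: {ffun coordinate -> bool}}]%fset.

Definition code_condition (C : {fset vec}) : bool :=
  [forall v : C, forall w : C, (v != w) ==> (dot (val v) (val w) <= 4)%R].

Definition max_code_size (H : {set edge}) : nat :=
  \max_(F : {set {set coordinate}} |
          allowed_family H F && code_condition (transferred_code F))
     #|` transferred_code F|%fset.

(* Main.v *)
(* A block of type a takes one coordinate from each of four pairs.  If a and b
   share their left type P, their right types share a pair q, so the members
   chosen in the pairs of P and in q determine a block of type a or b within a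
   compatible family; hence c_a <= 8 and c_a + c_b <= 8.  Summing over a maximum
   matching N of D_H, every type is counted twice, which gives
   2 |F| <= 16 h - 8 nu(D_H) with equality exactly under the stated conditions.

   By Koenig, D_H has a vertex cover with nu(D_H) vertices.  Giving weight
   8 - 4 (number of covered copies of a) to a, the types of weight 8 form a
   matching M of H and the remaining positive weights, all 4, are in
   E(H - V(M)).  The weights are realised by blocks: colour the edges of each
   octahedron K_{2,2,2} with four colours such that every colour class is a
   perfect matching containing one edge of each type.  A type in E(H - V(M))
   takes the blocks made of two edges of the same colour; a type in M can take
   eight blocks, since no other type used shares an endpoint with it. *)

Require Import Defs.
From HB Require Import structures.
From mathcomp Require Import all_boot all_order all_algebra.
From mathcomp Require Import finmap.
From mathcomp Require Import zify ring lra.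

Set Implicit Arguments.
Unset Strict Implicit.
Unset Printing Implicit Defensive.

Import Order.TTheory GRing.Theory Num.Theory.

(** * Koenig's theorem by uncrossing vertex covers *)

Section Konig.

Variables A B : finType.
Implicit Types (E M : {set A * B}) (S : {set A}) (T : {set B}).

Definition covers E S T : bool :=
  [forall e in E, (e.1 \in S) || (e.2 \in T)].

Lemma coversP E S T :
  reflect (forall x y, (x, y) \in E -> (x \in S) || (y \in T)) (covers E S T).
Proof.
apply: (iffP forall_inP) => [cov x y /cov //|cov [x y] /cov //].
Qed.

Lemma card_matching_le E M : is_matching E M -> #|M| <= matching_number E.
Proof. by move=> mM; apply: (leq_bigmax_cond (F := fun M : {set A * B} => #|M|)). Qed.

Lemma matching_number_mono E E' :
  E' \subset E -> matching_number E' <= matching_number E.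
Proof.
move=> sub; apply/bigmax_leqP => M /andP[sM mM]; apply: card_matching_le.
by rewrite /is_matching mM (subset_trans sM sub).
Qed.

Lemma matching_number_witness E :
  exists2 M, is_matching E M & #|M| = matching_number E.
Proof.
have m0 : is_matching E set0.
  by rewrite /is_matching sub0set; apply/forall_inP => e; rewrite inE.
have [|M mM eM] := @eq_bigmax_cond _ (is_matching E) (fun M : {set A * B} => #|M|).
  by apply/card_gt0P; exists set0.
by exists M; rewrite // /matching_number eM.
Qed.

(** Neither cover contains [x], or it would already cover [E]; hence [y'] is in [Te] and [y] in
    [Tf]. Intersecting on the left and uniting on the right then covers [E], and so does uniting on
    the left, adding [x], and intersecting on the right. Were both given covers smaller than [k],
    these two sizes would sum to at most 2k - 1. *)
Lemma uncross_left E k (x : A) (y y' : B) (Se Sf : {set A}) (Te Tf : {set B}) :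
  y != y' -> (x, y) \in E -> (x, y') \in E ->
  (forall S T, covers E S T -> k <= #|S| + #|T|) ->
  covers (E :\ (x, y)) Se Te -> covers (E :\ (x, y')) Sf Tf ->
  #|Se| + #|Te| < k -> k <= #|Sf| + #|Tf|.
Proof.
move=> yy' eE fE mink /coversP ce /coversP cf ltk; rewrite leqNgt; apply/negP => ltk'.
have ncov S T : #|S| + #|T| < k -> ~ covers E S T.
  by move=> lt /mink; rewrite leqNgt lt.
have xSe : x \notin Se.
  apply/negP => xS; apply: (ncov Se Te) => //; apply/coversP => u v uvE.
  have [[-> _]|ne] := eqVneq (u, v) (x, y); first by rewrite xS.
  by apply: ce; rewrite !inE ne.
have xSf : x \notin Sf.
  apply/negP => xS; apply: (ncov Sf Tf) => //; apply/coversP => u v uvE.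
  have [[-> _]|ne] := eqVneq (u, v) (x, y'); first by rewrite xS.
  by apply: cf; rewrite !inE ne.
have y'Te : y' \in Te.
  have := ce x y'; rewrite !inE fE xpair_eqE eqxx eq_sym yy' (negPf xSe) /=.
  exact.
have yTf : y \in Tf.
  have := cf x y; rewrite !inE eE xpair_eqE eqxx yy' (negPf xSf) /=.
  exact.
have cov1 : covers E (Se :&: Sf) (Te :|: Tf).
  apply/coversP => u v uvE; rewrite !inE.
  have [[-> ->]|ne] := eqVneq (u, v) (x, y); first by rewrite yTf !orbT.
  have [[-> ->]|ne'] := eqVneq (u, v) (x, y'); first by rewrite y'Te !orbT.
  have := ce u v; have := cf u v; rewrite !inE ne ne' uvE => /(_ isT) + /(_ isT).
  by do 4 case: (_ \in _).
have cov2 : covers E (x |: (Se :|: Sf)) (Te :&: Tf).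
  apply/coversP => u v uvE; rewrite !inE.
  have [[-> ->]|ne] := eqVneq (u, v) (x, y); first by rewrite eqxx.
  have [[-> ->]|ne'] := eqVneq (u, v) (x, y'); first by rewrite eqxx.
  have := ce u v; have := cf u v; rewrite !inE ne ne' uvE => /(_ isT) + /(_ isT).
  by case: (u == x) => //=; do 4 case: (_ \in _).
have := mink _ _ cov1; have := mink _ _ cov2.
rewrite cardsU1; have := cardsUI Se Sf; have := cardsUI Te Tf.
have := leq_b1 (x \notin Se :|: Sf).
lia.
Qed.

End Konig.

Section Swap.
Variables A B : finType.
Definition swap_graph (E : {set A * B}) : {set B * A} := [set e | (e.2, e.1) \in E].

Lemma covers_swap E (S : {set A}) (T : {set B}) :
  covers (swap_graph E) T S = covers E S T.
Proof.
by apply/coversP/coversP => c x y xyE; rewrite orbC; apply: c; rewrite ?inE // in xyE *.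
Qed.
End Swap.

(** Transposing the graph reduces this to [uncross_left]. *)
Lemma uncross_right (A B : finType) (E : {set A * B}) k (x x' : A) (y : B)
    (Se Sf : {set A}) (Te Tf : {set B}) :
  x != x' -> (x, y) \in E -> (x', y) \in E ->
  (forall S T, covers E S T -> k <= #|S| + #|T|) ->
  covers (E :\ (x, y)) Se Te -> covers (E :\ (x', y)) Sf Tf ->
  #|Se| + #|Te| < k -> k <= #|Sf| + #|Tf|.
Proof.
move=> xx' eE fE mink ce cf; rewrite (addnC #|Se|) (addnC #|Sf|).
have swapD z : swap_graph (E :\ (z, y)) = swap_graph E :\ (y, z).
  by apply/setP => -[u v]; rewrite !inE /= !xpair_eqE [(v == z) && _]andbC.
apply: (@uncross_left _ _ (swap_graph E) k y x x'); rewrite ?inE //.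
- by move=> T S; rewrite covers_swap addnC; apply: mink.
- by rewrite -swapD covers_swap.
- by rewrite -swapD covers_swap.
Qed.

Section KonigTheorem.
Variables A B : finType.
Implicit Types (E M : {set A * B}) (S : {set A}) (T : {set B}).

(** Induction on the number of edges. An edge whose deletion keeps every cover at size at least [k]
    is dropped. If there is none, every edge is critical, and uncrossing forbids two critical edges
    with a common endpoint, so [E] is itself a matching. *)
Lemma konig_min E k :
  (forall S T, covers E S T -> k <= #|S| + #|T|) -> k <= matching_number E.
Proof.
have [n] := ubnP #|E|; elim: n => // n IH in E * => /ltnSE cE mink.
have [/exists_inP[e eE /forallP de]|nodel] := boolP [exists e in E,
    [forall S, forall T, covers (E :\ e) S T ==> (k <= #|S| + #|T|)]].
  apply: leq_trans (matching_number_mono (subsetDl E [set e])); apply: IH.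
    by have := cardsD1 e E; rewrite eE; lia.
  by move=> S T; move: (de S) => /forallP/(_ T)/implyP.
have small e : e \in E ->
    exists2 ST : {set A} * {set B}, covers (E :\ e) ST.1 ST.2 & #|ST.1| + #|ST.2| < k.
  move=> eE; move: nodel; rewrite negb_exists_in => /forall_inP/(_ e eE).
  rewrite negb_forall => /existsP[S]; rewrite negb_forall => /existsP[T].
  by rewrite negb_imply -ltnNge => /andP[c l]; exists (S, T).
(* The left ends of [E] form a cover with at most [#|E|] vertices, so [k <= #|E|]. *)
suff mE : is_matching E E.
  apply: leq_trans (card_matching_le mE).
  have : covers E (left_ends E) set0.
    by apply/coversP => x y xyE; apply/orP; left; apply/imsetP; exists (x, y).
  move/mink; rewrite cards0 addn0 => /leq_trans; apply; exact: leq_imset_card.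
rewrite /is_matching subxx; apply/forall_inP => -[x y] eE; apply/forall_inP => -[x' y'] fE.
apply/implyP => ne; apply/negP => sh.
have [[Se Te] /= ce le] := small _ eE; have [[Sf Tf] /= cf lf] := small _ fE.
suff : k <= #|Sf| + #|Tf| by rewrite leqNgt lf.
move: sh ne; rewrite /share_endpoint /= xpair_eqE.
move=> /orP[]/eqP E0; subst; rewrite eqxx ?andbT /= => ne.
  exact: (uncross_left ne eE fE mink ce cf).
exact: (uncross_right ne eE fE mink ce cf).
Qed.

Lemma konig E :
  exists S T, covers E S T /\ #|S| + #|T| <= matching_number E.
Proof.
have [/existsP[S /existsP[T /andP[]]]|] :=
    boolP [exists S, exists T, covers E S T && (#|S| + #|T| <= matching_number E)].
  by exists S, T.
move=> no; suff : (matching_number E).+1 <= matching_number E by rewrite ltnn.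
apply: konig_min => S T c; rewrite ltnNge; apply: contra no => le.
by apply/existsP; exists S; apply/existsP; exists T; rewrite c.
Qed.

End KonigTheorem.

(** * At most eight blocks of two types sharing an endpoint *)

Implicit Types (X Y : {set coordinate}) (F : {set {set coordinate}}).
Implicit Types (H M : {set edge}).

Lemma pairs_metP b X p :
  reflect (exists i, (b, p, i) \in X) (p \in pairs_met b X).
Proof. by rewrite inE; apply: existsP. Qed.

Lemma pairs_met_imset b X :
  pairs_met b X = [set x.1.2 | x in X :&: side b].
Proof.
apply/setP => p; apply/pairs_metP/imsetP => [[i iX]|[[[c q] i]]].
  by exists (b, p, i); rewrite ?inE ?iX /=.
by rewrite !inE /= => /andP[iX /eqP <-] ->; exists i.
Qed.

Lemma card_sides (X : {set coordinate}) : #|X| = #|X :&: side false| + #|X :&: side true|.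
Proof.
rewrite -(cardsID (side false) X); congr (_ + _); apply: eq_card => -[[b p] i].
by rewrite !inE /= andbC; case: b.
Qed.

Lemma card_source_block X : source_block X -> #|X| = 4.
Proof.
move=> /forallP sX; rewrite card_sides.
by have /andP[/eqP -> _] := sX false; have /andP[/eqP -> _] := sX true.
Qed.

Lemma compatibleP (F : {set {set coordinate}}) :
  reflect (forall X Y, X \in F -> Y \in F -> X != Y -> #|X :&: Y| <= 2) (compatible F).
Proof.
apply: (iffP forall_inP) => [c X Y XF YF|c X XF].
  by move/(_ X XF)/forall_inP: c => /(_ Y YF)/implyP.
by apply/forall_inP => Y YF; apply/implyP; apply: c.
Qed.

(* Which of its members a block takes in the pairs p1, p2, q determines three
   of its coordinates, hence the block itself within a compatible family. *)
Lemma compatible_card_le8 (F : {set {set coordinate}}) b (p1 p2 q : 'I_3) :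
  compatible F -> p1 != p2 ->
  (forall X, X \in F -> [/\ p1 \in pairs_met b X, p2 \in pairs_met b X
     & q \in pairs_met (~~ b) X]) ->
  #|F| <= 8.
Proof.
move=> /compatibleP cF p12 hF.
pose f (X : {set coordinate}) :=
  ((b, p1, ord0) \in X, (b, p2, ord0) \in X, (~~ b, q, ord0) \in X).
(* A pair has two members, so two sets that meet it and agree about member 0 share a member: 0 if
   they contain it, otherwise 1. *)
have agree X Y c p :
    p \in pairs_met c X -> p \in pairs_met c Y ->
    ((c, p, ord0) \in X) = ((c, p, ord0) \in Y) ->
    exists i, (c, p, i) \in X :&: Y.
  move=> /pairs_metP[i iX] /pairs_metP[j jY] e0.
  have [i0|ni0] := eqVneq i ord0.
    by rewrite i0 in iX; exists ord0; rewrite inE -e0 iX.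
  have [j0|nj0] := eqVneq j ord0.
    by rewrite j0 in jY; exists ord0; rewrite inE e0 jY.
  suff ij : i = j by exists i; rewrite inE iX ij.
  by apply/val_inj; case: i ni0 {iX} => [[|[|?]]] //; case: j nj0 {jY} => [[|[|?]]].
have injf : {in F &, injective f}.
  move=> X Y XF YF [e1 e2 e3]; apply/eqP; apply: contraT => XY.
  have [X1 X2 Xq] := hF _ XF; have [Y1 Y2 Yq] := hF _ YF.
  have [i1 h1] := agree _ _ _ _ X1 Y1 e1.
  have [i2 h2] := agree _ _ _ _ X2 Y2 e2.
  have [i3 h3] := agree _ _ _ _ Xq Yq e3.
  have := cF X Y XF YF XY; rewrite leqNgt => /negP[].
  have <- : #|(b, p1, i1) |: [set (b, p2, i2); (~~ b, q, i3)]| = 3.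
    rewrite cardsU1 cards2 !inE !xpair_eqE (negPf p12) /=.
    by case: (b).
  by apply: subset_leq_card; apply/subsetP => z; rewrite in_setU1 in_set2 => /or3P[]/eqP->.
rewrite -(card_in_imset injf); apply: leq_trans (max_card _) _.
by rewrite !card_prod card_bool.
Qed.

Lemma pair_type_card (P : pair_type) : #|val P| = 2.
Proof. exact/eqP/(valP P). Qed.

Lemma pair_types_meet (P Q : pair_type) : exists q, q \in val P :&: val Q.
Proof.
apply/set0Pn; rewrite -card_gt0.
have := cardsUI (val P) (val Q); rewrite !pair_type_card.
have := subset_leq_card (subsetT (val P :|: val Q)); rewrite cardsT card_ord; lia.
Qed.

Lemma pair_type_two (P : pair_type) : exists p1 p2, [/\ p1 != p2, p1 \in val P & p2 \in val P].
Proof.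
have /cards2P[p1 [p2 [ne ->]]] := valP P.
by exists p1, p2; rewrite !inE !eqxx orbT.
Qed.

Lemma block_of_typeP a X :
  reflect [/\ source_block X, pairs_met false X = val a.1
            & pairs_met true X = val a.2] (block_of_type a X).
Proof. by apply: (iffP and3P) => -[-> /eqP-> /eqP->]. Qed.

Lemma block_of_type_inj a b X : block_of_type a X -> block_of_type b X -> a = b.
Proof.
case: a b => [P Q] [P' Q'] /block_of_typeP[_ /= eP eQ] /block_of_typeP[_ /=].
by rewrite eP eQ => /val_inj -> /val_inj ->.
Qed.

Lemma sub_compatible (F G : {set {set coordinate}}) :
  G \subset F -> compatible F -> compatible G.
Proof.
move=> /subsetP sGF /compatibleP cF; apply/compatibleP => X Y XG YG.
by apply: cF; apply: sGF.
Qed.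

(** The shared type supplies two common pairs on its side; the types on the other side have a common
    pair since 2 + 2 > 3. The case [a = b] bounds a single type. *)
Lemma card_types_le8 (F : {set {set coordinate}}) a b :
  compatible F -> share_endpoint a b ->
  #|[set X in F | block_of_type a X || block_of_type b X]| <= 8.
Proof.
move=> cF; set G := [set X in F | _].
have cG : compatible G by apply: sub_compatible cF; rewrite /G setIdE subsetIl.
case/orP=> /eqP eab.
  have [p1 [p2 [ne h1 h2]]] := pair_type_two a.1.
  have [q] := pair_types_meet a.2 b.2; rewrite inE => /andP[qa qb].
  apply: (@compatible_card_le8 G false p1 p2 q) => // X.
  by rewrite inE => /andP[_ /orP[]/block_of_typeP[_ -> ->]]; rewrite -?eab.
have [p1 [p2 [ne h1 h2]]] := pair_type_two a.2.
have [q] := pair_types_meet a.1 b.1; rewrite inE => /andP[qa qb].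
apply: (@compatible_card_le8 G true p1 p2 q) => // X.
by rewrite inE => /andP[_ /orP[]/block_of_typeP[_ -> ->]]; rewrite -?eab.
Qed.

Lemma type_count_le8 F a : compatible F -> type_count F a <= 8.
Proof.
move=> cF; apply: leq_trans (card_types_le8 (a := a) (b := a) cF _).
  by apply: subset_leq_card; apply/subsetP => X; rewrite !inE => /andP[-> ->].
by rewrite /share_endpoint eqxx.
Qed.

Lemma type_count_add_le8 F a b : compatible F -> a != b -> share_endpoint a b ->
  type_count F a + type_count F b <= 8.
Proof.
move=> cF ab sh; apply: leq_trans (card_types_le8 cF sh).
rewrite /type_count -cardsUI (_ : _ :&: _ = set0) ?cards0 ?addn0.
  by apply: subset_leq_card; apply/subsetP => X; rewrite !inE -andb_orr.
apply/setP => X; rewrite !inE; apply/negP => /andP[/andP[_ aX] /andP[_ bX]].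
by rewrite (block_of_type_inj aX bX) eqxx in ab.
Qed.

Lemma allowed_familyP (H : {set edge}) (F : {set {set coordinate}}) :
  reflect (forall X, X \in F -> exists2 a, a \in H & block_of_type a X) (allowed_family H F).
Proof.
by apply: (iffP forall_inP) => h X /h => [/exists_inP|ex]; last exact/exists_inP.
Qed.

(** The type of a block is unique, so each block is counted exactly once. *)
Lemma card_allowed H F : allowed_family H F -> #|F| = \sum_(a in H) type_count F a.
Proof.
move=> /allowed_familyP aF.
have tc a : type_count F a = \sum_(X in F) block_of_type a X.
  rewrite /type_count -sum1_card (eq_bigl (fun X => (X \in F) && block_of_type a X)).
    by rewrite big_mkcondr.
  by move=> X; rewrite inE.
under eq_bigr do rewrite tc.
rewrite exchange_big /= -sum1_card; apply: eq_bigr => X /aF[a aH aX].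
rewrite (bigD1 a) //= aX big1 // => b /andP[_ ba].
by apply/eqP; rewrite eqb0; apply: contra ba => bX; apply/eqP/(block_of_type_inj bX aX).
Qed.

(** * Blocks from a 1-factorization of the octahedron *)

Implicit Types (c d : bool * bool) (P Q : pair_type) (p q : 'I_3).

(* The words of even weight in F_2^3. *)
Definition even_word c p : bool := nth false [:: c.1; c.2; c.1 (+) c.2] p.

(** The letters of an even word sum to zero, so any two of them determine the third. *)
Lemma even_word_inj c d p q :
  p != q -> even_word c p = even_word d p -> even_word c q = even_word d q -> c = d.
Proof.
case: c d p q => [[] []] [[] []] [[|[|[|?]]] ?] // [[|[|[|?]]] ?] //.
Qed.

(** The indicator of a two-element subset has even weight, so its first two letters serve as [c]. *)
Lemma pair_type_even_word P : exists c, forall p, (p \in val P) = even_word c p.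
Proof.
exists (ord0 \in val P, lift ord0 ord0 \in val P) => p.
have := pair_type_card P; rewrite -sum1_card big_mkcond !big_ord_recl big_ord0 /=.
case: (unliftP ord0 p) => [j ->|-> //]; case: (unliftP ord0 j) => [k ->|-> //].
have -> : k = ord0 by apply: ord1.
by rewrite /even_word /=; do 3 case: (_ \in _).
Qed.

Lemma pair_type_inj P Q p q : p != q ->
  (p \in val P) = (p \in val Q) -> (q \in val P) = (q \in val Q) -> P = Q.
Proof.
have [[c eP] [d eQ]] := (pair_type_even_word P, pair_type_even_word Q).
move=> pq; rewrite !eP !eQ => h1 h2; apply/val_inj/setP => r.
by rewrite eP eQ (even_word_inj pq h1 h2).
Qed.

Lemma ord_pred_neq p : ord_pred p != p.
Proof. by case: p => [[|[|[|?]]] ?]; rewrite -val_eqE. Qed.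

(* For fixed c, the edges (P, c) of the octahedron are pairwise disjoint: the
   four words c give a 1-factorization of K_{2,2,2} into perfect matchings
   which contain one edge of each type. *)
Definition pick_member P c p : 'I_2 :=
  if even_word c p (+) (ord_pred p \in val P) then ord_max else ord0.

Definition pair_edge b P c : {set coordinate} :=
  [set (b, p, pick_member P c p) | p in val P].

Definition common P c Q d : {set 'I_3} :=
  [set p in val P :&: val Q | pick_member P c p == pick_member Q d p].

Lemma commonP P c Q d p :
  reflect [/\ p \in val P, p \in val Q & pick_member P c p = pick_member Q d p]
          (p \in common P c Q d).
Proof.
rewrite in_set in_setI -andbA.
by apply: (iffP and3P) => [[-> -> /eqP]|[-> -> ->]].
Qed.

Lemma card_pair_edgeI b P c Q d :
  #|pair_edge b P c :&: pair_edge b Q d| = #|common P c Q d|.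
Proof.
rewrite -(card_imset (common P c Q d) (f := fun p => (b, p, pick_member P c p)));
  last by move=> p q [].
apply: eq_card => x; rewrite inE; apply/andP/imsetP => [[/imsetP[p pP ->] /imsetP[q qQ [pq e]]]|].
  by subst q; exists p => //; apply/commonP.
by case=> p /commonP[pP pQ e] ->; split; apply/imsetP; exists p; rewrite -?e.
Qed.

Lemma common_le2 P c Q d : #|common P c Q d| <= 2.
Proof.
rewrite -[leqRHS](pair_type_card P); apply: subset_leq_card; apply/subsetP => p.
by case/commonP.
Qed.

Lemma pick_member_eq P c d p :
  pick_member P c p = pick_member P d p -> even_word c p = even_word d p.
Proof. by rewrite /pick_member; do 2 case: even_word; case: (_ \in _). Qed.

(** Two common pairs would force [P = Q], and agreement of the chosen members at both would then
    force [c = d]. *)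
Lemma common_le1 P c Q d : (P, c) != (Q, d) -> #|common P c Q d| <= 1.
Proof.
move=> ne; apply/card_le1_eqP => p q /commonP[pP pQ ep] /commonP[qP qQ eq].
apply/eqP; apply: contraT => pq.
have PQ : P = Q by exact: pair_type_inj pq (etrans qP (esym qQ)) (etrans pP (esym pQ)).
subst Q; have cd : c = d by exact: even_word_inj pq (pick_member_eq eq) (pick_member_eq ep).
by rewrite cd eqxx in ne.
Qed.

(** Distinct types that both contain [p] disagree about [ord_pred p], since agreement at two pairs
    makes types equal; this is the bit that [pick_member] adds to the letter of [c]. *)
Lemma common_same_word P Q c : P != Q -> common P c Q c = set0.
Proof.
move=> PQ; apply/setP => p; rewrite [RHS]inE; apply/negP => /commonP[pP pQ].
have : (ord_pred p \in val P) != (ord_pred p \in val Q).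
  apply: contra PQ => /eqP e; apply/eqP; apply: (pair_type_inj (ord_pred_neq p)) => //.
  by rewrite pP pQ.
by rewrite /pick_member; case: even_word; case: (_ \in val P); case: (_ \in val Q).
Qed.

(** Exactly one pair lies outside [P], so this is the letter of [c] there. It splits the four edges
    of type [P], which form a K_{2,2}, into its two perfect matchings. *)
Definition missing_bit P c : bool := [exists p, (p \notin val P) && even_word c p].

Lemma missing_bitE P : exists2 k, k \notin val P & forall c, missing_bit P c = even_word c k.
Proof.
have /cards1P[k ek] : #|~: val P| == 1.
  by have := cardsC (val P); rewrite pair_type_card card_ord; lia.
have inC p : (p \notin val P) = (p == k) by rewrite -in_setC ek inE.
exists k => [|c]; first by rewrite inC.
apply/existsP/idP => [[p]|]; first by rewrite inC => /andP[/eqP->].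
by exists k; rewrite inC eqxx.
Qed.

(** Distinct words that agree outside [P] must differ at both pairs of [P]. *)
Lemma common_same_bit P c d :
  c != d -> missing_bit P c = missing_bit P d -> common P c P d = set0.
Proof.
have [k kP e] := missing_bitE P; rewrite !e => cd ek.
apply/setP => p; rewrite [RHS]inE; apply/negP => /commonP[pP _ /pick_member_eq ep].
by move/eqP: cd; apply; apply: even_word_inj ek ep; apply: contraNneq kP => ->.
Qed.

(** Each of the two bit values is taken by two words on either side, giving 2 * 2 * 2 choices. *)
Lemma card_missing_bit P Q :
  #|[set w : (bool * bool) * (bool * bool) | missing_bit P w.1 == missing_bit Q w.2]| = 8.
Proof.
have [[k _ ek] [l _ el]] := (missing_bitE P, missing_bitE Q).
rewrite -sum1_card big_mkcond /=.
under eq_bigr => w _ do rewrite inE ek el.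
rewrite -(pair_bigA _ (fun c d => if even_word c k == even_word d l then 1 else 0)) /=.
under eq_bigr => c _ do
  rewrite -(pair_bigA _ (fun x y => if even_word c k == even_word (x, y) l then 1 else 0)) /=.
rewrite -(pair_bigA _ (fun u v =>
  \sum_x \sum_y if even_word (u, v) k == even_word (x, y) l then 1 else 0)) /=.
rewrite !big_bool /even_word /=.
by case: k {ek} => [[|[|[|?]]] ?] //; case: l {el} => [[|[|[|?]]] ?].
Qed.

Lemma card_diagonal (T : finType) : #|[set w : T * T | w.1 == w.2]| = #|T|.
Proof.
rewrite -[RHS](card_imset _ (f := fun x : T => (x, x))); last by move=> x y [].
apply: eq_card => -[x y]; rewrite inE /=; apply/eqP/imsetP => [->|[z _ [-> ->]] //].
by exists y.
Qed.

(** * Blocks assembled from a left and a right pair edge *)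

Definition block (a : edge) (w : (bool * bool) * (bool * bool)) : {set coordinate} :=
  pair_edge false a.1 w.1 :|: pair_edge true a.2 w.2.

Lemma block_side a w b :
  block a w :&: side b = if b then pair_edge true a.2 w.2 else pair_edge false a.1 w.1.
Proof.
apply/setP => x; rewrite !inE; case: b; apply/andP/idP.
- by case=> /orP[] // /imsetP[p _ ->].
- by move=> h; rewrite h orbT; case/imsetP: h => p _ ->.
- by case=> /orP[] // /imsetP[p _ ->].
- by move=> h; rewrite h; case/imsetP: h => p _ ->.
Qed.

Lemma card_pair_edge b P c : #|pair_edge b P c| = 2.
Proof. by rewrite card_imset ?pair_type_card // => p q []. Qed.

Lemma pairs_met_block a w b : pairs_met b (block a w) = val (if b then a.2 else a.1).
Proof.
rewrite pairs_met_imset block_side; case: b; rewrite -imset_comp;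
by apply/setP => p; apply/imsetP/idP => [[q qP ->] //|pP]; exists p.
Qed.

Lemma block_of_type_block a w : block_of_type a (block a w).
Proof.
apply/block_of_typeP; rewrite !pairs_met_block; split=> //; apply/forallP => b.
rewrite pairs_met_block block_side.
by case: b; rewrite card_pair_edge pair_type_card.
Qed.

Lemma card_blockI a w a' w' : #|block a w :&: block a' w'| =
  #|common a.1 w.1 a'.1 w'.1| + #|common a.2 w.2 a'.2 w'.2|.
Proof.
rewrite card_sides -(card_pair_edgeI false) -(card_pair_edgeI true).
by congr (_ + _); congr #|pred_of_set _|; rewrite setIIl !block_side.
Qed.

Lemma block_inj a : injective (block a).
Proof.
have e_inj b P c d : pair_edge b P c = pair_edge b P d -> c = d.
  move=> e; have := card_pair_edgeI b P c P d; rewrite e setIid card_pair_edge => h.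
  apply/eqP; apply: contraT => cd; have := @common_le1 P c P d.
  by rewrite -h xpair_eqE eqxx => /(_ cd).
move=> [c d] [c' d'] e; congr pair.
  by have := congr1 (fun X => X :&: side false) e; rewrite !block_side => /e_inj.
by have := congr1 (fun X => X :&: side true) e; rewrite !block_side => /e_inj.
Qed.

Lemma sum_mem_card (T : finType) (A B : {set T}) : \sum_(a in A) (a \in B) = #|A :&: B|.
Proof.
rewrite -sum1_card [RHS](eq_bigl (fun a => (a \in A) && (a \in B))) => [|a]; last by rewrite inE.
by rewrite big_mkcondr; apply: eq_bigr => a _; case: (a \in B).
Qed.

(** * The block family attached to a matching of H *)

Section Design.
Variables H M : {set edge}.
Hypothesis mM : is_matching H M.

Definition linked (a : edge) (w : (bool * bool) * (bool * bool)) : bool :=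
  if a \in M then missing_bit a.1 w.1 == missing_bit a.2 w.2
  else (a \in delete_ends H M) && (w.1 == w.2).

Definition design : {set {set coordinate}} :=
  [set block t.1 t.2 | t in [set t : edge * ((bool * bool) * (bool * bool)) |
                                 (t.1 \in H) && linked t.1 t.2]].

Lemma designP X :
  reflect (exists a w, [/\ a \in H, linked a w & X = block a w]) (X \in design).
Proof.
apply: (iffP imsetP) => [[[a w]]|[a [w [aH l ->]]]].
  by rewrite inE => /andP[aH l] ->; exists a, w.
by exists (a, w); rewrite // inE aH.
Qed.

Lemma allowed_design : allowed_family H design.
Proof.
apply/allowed_familyP => X /designP[a [w [aH _ ->]]].
by exists a; rewrite ?block_of_type_block.
Qed.

(** A type [b] in use lies in [M] or avoids V(M); neither lets it share an endpoint with a different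
    type in [M]. *)
Lemma linked_sharing a b w : a != b -> share_endpoint a b ->
  a \in H -> b \in H -> linked b w -> a \notin M.
Proof.
move=> ab sh aH bH lb; apply/negP => aM; move: lb; rewrite /linked.
case: ifP => [bM|_ /andP[]].
  move: mM => /andP[_ /forall_inP/(_ a aM)/forall_inP/(_ b bM)/implyP/(_ ab)].
  by rewrite sh.
rewrite inE => /and3P[_ bl br] _; case/orP: sh => /eqP e.
  by move/negP: bl; apply; rewrite -e; apply: imset_f.
by move/negP: br; apply; rewrite -e; apply: imset_f.
Qed.

(** Suppose the blocks coincide on one side. If their types on the other side are equal too, only a
    type in [M] leaves room for two different words there, and these have equal missing bits. If
    not, both types are outside [M], so the rule of equal colours gives both edges one colour.
    Either way the edges on the other side are disjoint. *)
Lemma linked_common a b w v : a \in H -> b \in H -> linked a w -> linked b v ->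
  (a, w) != (b, v) ->
  ((a.1, w.1) = (b.1, v.1) -> common a.2 w.2 b.2 v.2 = set0) /\
  ((a.2, w.2) = (b.2, v.2) -> common a.1 w.1 b.1 v.1 = set0).
Proof.
move=> aH bH la lb ne.
have diag : a != b -> share_endpoint a b -> w.1 = w.2 /\ v.1 = v.2.
  move=> ab sh; have aM := linked_sharing ab sh aH bH lb.
  have bM : b \notin M.
    apply: (linked_sharing _ _ bH aH la); first by rewrite eq_sym.
    by move: sh; rewrite /share_endpoint eq_sym [a.2 == _]eq_sym.
  by move: la lb; rewrite /linked (negPf aM) (negPf bM) => /andP[_ /eqP->] /andP[_ /eqP->].
case: a b w v => [P Q] [P' Q'] [c d] [c' d'] /= in aH bH la lb ne diag *; split=> -[? ?]; subst.
  have [QQ|nQ] := eqVneq Q Q'; last first.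
    have [] := diag; rewrite /share_endpoint ?xpair_eqE ?eqxx ?nQ // => <- <-.
    exact: common_same_word.
  subst; have nd : d != d' by apply: contraNneq ne => ->.
  apply: common_same_bit => //; move: la lb; rewrite /linked /=.
  case: ifP => _; first by move=> /eqP <- /eqP.
  by move=> /andP[_ /eqP e] /andP[_ /eqP e']; rewrite -e e' eqxx in nd.
have [PP|nP] := eqVneq P P'; last first.
  have [] := diag; rewrite /share_endpoint ?xpair_eqE ?eqxx ?orbT ?andbT ?nP // => -> ->.
  exact: common_same_word.
subst; have nc : c != c' by apply: contraNneq ne => ->.
apply: common_same_bit => //; move: la lb; rewrite /linked /=.
case: ifP => _; first by move=> /eqP -> /eqP.
by move=> /andP[_ /eqP e] /andP[_ /eqP e']; rewrite e e' eqxx in nc.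
Qed.

Lemma compatible_design : compatible design.
Proof.
apply/compatibleP => _ _ /designP[a [w [aH la ->]]] /designP[b [v [bH lb ->]]] XY.
have ne : (a, w) != (b, v) by apply: contraNneq XY => -[-> ->].
have [h1 h2] := linked_common aH bH la lb ne.
rewrite card_blockI.
(* The intersection splits as 2 + 0, as 0 + 2, or as at most 1 + 1. *)
have [/h1 ->|n1] := eqVneq (a.1, w.1) (b.1, v.1); first by rewrite cards0 addn0 common_le2.
have [/h2 ->|n2] := eqVneq (a.2, w.2) (b.2, v.2); first by rewrite cards0 common_le2.
exact: (leq_add (common_le1 n1) (common_le1 n2)).
Qed.

Lemma type_count_design a : a \in H ->
  type_count design a = 8 * (a \in M) + 4 * (a \in delete_ends H M).
Proof.
move=> aH; have -> : type_count design a = #|[set w | linked a w]|.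
  rewrite -(card_imset _ (@block_inj a)); apply: eq_card => X; rewrite inE.
  apply/andP/imsetP => [[/designP[b [w [bH lb ->]]] aX]|[w]].
    have e := block_of_type_inj aX (block_of_type_block b w); subst b.
    by exists w; rewrite ?inE.
  rewrite inE => la ->; split; last exact: block_of_type_block.
  by apply/designP; exists a, w.
rewrite /linked; case: (boolP (a \in M)) => aM.
  have aL : a.1 \in left_ends M by apply: imset_f.
  by rewrite card_missing_bit inE aL andbF.
case: (a \in delete_ends H M) => /=.
  by rewrite card_diagonal card_prod card_bool.
by rewrite (_ : [set _ | _] = set0) ?cards0 //; apply/setP => w; rewrite !inE.
Qed.

Lemma card_design : #|design| = 8 * #|M| + 4 * #|delete_ends H M|.
Proof.
have /andP[sM _] := mM.
have sD : delete_ends H M \subset H by rewrite /delete_ends setIdE subsetIl.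
rewrite (card_allowed allowed_design) (eq_bigr _ type_count_design) big_split /=.
by rewrite -!big_distrr /= !sum_mem_card (setIidPr sM) (setIidPr sD).
Qed.

End Design.

(** * Counting along a matching of D_H *)

Section Accounting.
Variables (H : {set edge}) (N : {set edge * edge}).
Hypothesis mN : is_matching (D H) N.

Lemma matching_fst_inj : {in N &, injective (fun e : edge * edge => e.1)}.
Proof.
move=> e f eN fN ef; apply/eqP; apply: contraT => ne.
have /andP[_ /forall_inP/(_ e eN)/forall_inP/(_ f fN)/implyP/(_ ne)] := mN.
by rewrite /share_endpoint ef eqxx.
Qed.

Lemma matching_snd_inj : {in N &, injective (fun e : edge * edge => e.2)}.
Proof.
move=> e f eN fN ef; apply/eqP; apply: contraT => ne.
have /andP[_ /forall_inP/(_ e eN)/forall_inP/(_ f fN)/implyP/(_ ne)] := mN.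
by rewrite /share_endpoint ef eqxx orbT.
Qed.

Lemma matched_edge a b : (a, b) \in N ->
  [/\ a \in H, b \in H, a != b & share_endpoint a b].
Proof. by have /andP[/subsetP sN _] := mN; move/sN; rewrite inE => /and4P[]. Qed.

Lemma left_ends_sub : left_ends N \subset H.
Proof. by apply/subsetP => _ /imsetP[[a b] /matched_edge[aH bH _ _] ->]. Qed.

Lemma right_ends_sub : right_ends N \subset H.
Proof. by apply/subsetP => _ /imsetP[[a b] /matched_edge[aH bH _ _] ->]. Qed.

(** Each type has two copies. An edge of [N] accounts for one minus copy and one plus copy; the last
    two sums collect the unmatched minus and plus copies. *)
Lemma double_count (c : edge -> nat) :
  2 * \sum_(a in H) c a =
  \sum_(e in N) (c e.1 + c e.2) + \sum_(a in H :\: left_ends N) c a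
    + \sum_(a in H :\: right_ends N) c a.
Proof.
rewrite big_split /= mul2n -addnn.
rewrite [X in X + _](big_setID (left_ends N)).
rewrite [X in _ + X = _](big_setID (right_ends N)) /=.
rewrite (setIidPr left_ends_sub) (setIidPr right_ends_sub).
rewrite (big_imset _ matching_fst_inj) (big_imset _ matching_snd_inj) /=; lia.
Qed.

(** Bounding every term of [double_count] by 8 gives 8|N| + 2 * 8(h - |N|) = 16h - 8|N|. The [leqif]
    form keeps the equality case, which yields the optimality criterion when [N] is maximum. *)
Lemma leqif_card_family F : allowed_family H F -> compatible F ->
  2 * #|F| + 8 * #|N| <= 16 * #|H| ?= iff
    [&& [forall e in N, type_count F e.1 + type_count F e.2 == 8],
        [forall a in H :\: left_ends N, type_count F a == 8]
      & [forall a in H :\: right_ends N, type_count F a == 8]].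
Proof.
move=> aF cF; rewrite (card_allowed aF) double_count.
have hN : \sum_(e in N) (type_count F e.1 + type_count F e.2) <= \sum_(e in N) 8
    ?= iff [forall e in N, type_count F e.1 + type_count F e.2 == 8].
  apply: leqif_sum => -[a b] /matched_edge[_ _ ab sh].
  by split; first exact: type_count_add_le8.
have h1 (A : {set edge}) : \sum_(a in A) type_count F a <= \sum_(a in A) 8
    ?= iff [forall a in A, type_count F a == 8].
  by apply: leqif_sum => a _; split; first exact: type_count_le8.
have [le e] := leqif_add hN (leqif_add (h1 (H :\: left_ends N)) (h1 (H :\: right_ends N))).
rewrite -{}e !sum_nat_const in le *.
have cl := cardsID (left_ends N) H; rewrite (setIidPr left_ends_sub) in cl.
have cr := cardsID (right_ends N) H; rewrite (setIidPr right_ends_sub) in cr.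
rewrite /left_ends (card_in_imset matching_fst_inj) in cl.
rewrite /right_ends (card_in_imset matching_snd_inj) in cr.
move: cl cr le; rewrite -/(left_ends N) -/(right_ends N) => cl cr le.
by split; [|apply/eqP/eqP]; lia.
Qed.

End Accounting.

(** * The value of beta *)

Lemma card_family_le H F : allowed_family H F -> compatible F ->
  #|F| + 4 * matching_number (D H) <= 8 * #|H|.
Proof.
move=> aF cF; have [N mN <-] := matching_number_witness (D H).
have [] := leqif_card_family mN aF cF; lia.
Qed.

(* A minimum vertex cover (S, T) of D_H gives the half-integral optimum in
   which a has 8 - 4 [a^- in S] - 4 [a^+ in T] blocks. *)
Lemma exists_optimal_matching H : exists2 M, is_matching H M &
  8 * #|H| <= 8 * #|M| + 4 * #|delete_ends H M| + 4 * matching_number (D H).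
Proof.
have [S [T [/coversP cov leST]]] : exists S T : {set edge},
  covers (D H) S T /\ #|S| + #|T| <= matching_number (D H) by exact: konig.
pose M := [set a in H | (a \notin S) && (a \notin T)].
have inD a b : a \in H -> b \in H -> a != b -> share_endpoint a b ->
    (a \in S) || (b \in T).
  by move=> aH bH ab sh; apply: cov; rewrite inE /= aH bH ab.
have shC a b : share_endpoint a b = share_endpoint b a.
  by rewrite /share_endpoint eq_sym [a.2 == _]eq_sym.
(* Neither copy of [b] is covered. A common endpoint would put both a^- b^+ and b^- a^+ into D_H,
   forcing both copies of [a] into the cover, whereas exactly one is there. *)
have far a b : a \in H -> (a \in S) != (a \in T) -> b \in M -> ~~ share_endpoint a b.
  rewrite inE => aH aST /and3P[bH bS bT]; apply/negP => sh.
  have ab : a != b by apply: contraNneq aST => ->; rewrite (negPf bS) (negPf bT).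
  have := inD a b aH bH ab sh; rewrite (negPf bT) orbF => aS.
  rewrite shC in sh; rewrite eq_sym in ab.
  have := inD b a bH aH ab sh; rewrite (negPf bS) /= => aT.
  by rewrite aS aT in aST.
exists M.
  apply/andP; split; first by rewrite /M setIdE subsetIl.
  apply/forall_inP => a; rewrite inE => /and3P[aH aS aT].
  apply/forall_inP => b; rewrite inE => /and3P[bH bS bT].
  apply/implyP => ab; apply/negP => /(inD _ _ aH bH ab).
  by rewrite (negPf aS) (negPf bT).
(* A type with no covered copy is in [M]; with one, it is in [delete_ends H M] by [far]; with two,
   the cover terms alone give 8. *)
have pointwise a : a \in H ->
    8 <= 8 * (a \in M) + 4 * (a \in delete_ends H M) + 4 * (a \in S) + 4 * (a \in T).
  move=> aH; have : (a \in S) != (a \in T) -> a \in delete_ends H M.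
    move=> aST; rewrite inE aH /=; apply/andP; split; apply/negP => /imsetP[b bM e];
    by have := far a b aH aST bM; rewrite /share_endpoint e eqxx ?orbT.
  rewrite [a \in M]inE aH /=.
  by case: (a \in S); case: (a \in T); case: (a \in delete_ends H M) => //= /(_ isT).
have /= := leq_sum (index_enum edge) pointwise.
rewrite 3!big_split /= -!big_distrr /= !sum_mem_card sum_nat_const.
have cS : #|H :&: S| <= #|S| by apply: subset_leq_card; apply: subsetIr.
have cT : #|H :&: T| <= #|T| by apply: subset_leq_card; apply: subsetIr.
have cM : #|H :&: M| <= #|M| by apply: subset_leq_card; apply: subsetIr.
have cD : #|H :&: delete_ends H M| <= #|delete_ends H M|.
  by apply: subset_leq_card; apply: subsetIr.
move=> le; rewrite mulnC; apply: leq_trans le _; rewrite -addnA -mulnDr.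
by apply: leq_add; [apply: leq_add|]; rewrite leq_mul // (leq_trans (leq_add cS cT)).
Qed.

Lemma leq_beta H F : allowed_family H F -> compatible F -> #|F| <= beta H.
Proof.
move=> aF cF; apply: (leq_bigmax_cond (F := fun F : {set {set coordinate}} => #|F|)).
by rewrite aF.
Qed.

(** The additive form avoids truncated subtraction. One direction is the counting bound, the other
    the design of an optimal matching. *)
Lemma beta_eq H : beta H + 4 * matching_number (D H) = 8 * #|H|.
Proof.
apply/eqP; rewrite eqn_leq; apply/andP; split.
  have [M mM le] := exists_optimal_matching H.
  have := card_family_le (allowed_design H M) (compatible_design mM).
  move=> le0; suff : beta H <= 8 * #|H| - 4 * matching_number (D H) by lia.
  apply/bigmax_leqP => F /andP[aF cF].
  have := card_family_le aF cF; lia.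
have [M mM le] := exists_optimal_matching H.
rewrite (leq_trans le) // leq_add2r -card_design //.
exact: leq_beta (allowed_design H M) (compatible_design mM).
Qed.

(** * The transferred code *)

Section Code.
Local Open Scope ring_scope.
Implicit Types (v w : vec) (s t : {ffun coordinate -> bool}).

(** The columns of [hadamard2] are orthogonal of squared norm 2. The bound 4 on the code thus means
    2 before the transfer. *)
Lemma dot_transfer v w : dot (transfer v) (transfer w) = 2 * dot v w.
Proof.
pose G x := transfer v x * transfer w x.
pose K x := v x * w x.
rewrite /dot -/(\sum_x G x) -[X in _ = 2 * X]/(\sum_x K x).
rewrite (eq_bigr (fun x => G (x.1, x.2))) => [|[]//].
rewrite [X in _ = 2 * X](eq_bigr (fun x => K (x.1, x.2))) => [|[]//].
rewrite -(pair_bigA _ (fun y i => G (y, i))) -(pair_bigA _ (fun y i => K (y, i))) /=.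
rewrite big_distrr /=; apply: eq_bigr => y _.
by rewrite !big_ord_recl !big_ord0 /G /K !ffunE !big_ord_recl !big_ord0 !mxE /=; ring.
Qed.

Lemma signed_dot X Y s t :
  dot (signed_vec X s) (signed_vec Y t) = \sum_(x in X :&: Y) (-1) ^+ (s x (+) t x).
Proof.
rewrite /dot [RHS]big_mkcond; apply: eq_bigr => x _; rewrite !ffunE inE.
by case: (x \in X); case: (x \in Y); rewrite ?mulr0 ?mul0r // signr_addb.
Qed.

Lemma signed_dot_le X Y s t : dot (signed_vec X s) (signed_vec Y t) <= #|X :&: Y|%:Z.
Proof.
rewrite signed_dot -[Posz _]natz -sum1_card natr_sum ler_sum // => x _.
by case: (s x (+) t x); rewrite ?expr1 ?expr0.
Qed.

Lemma signed_dot_same X Y s : dot (signed_vec X s) (signed_vec Y s) = #|X :&: Y|%:Z.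
Proof.
rewrite signed_dot -[Posz _]natz -sum1_card natr_sum; apply: eq_bigr => x _.
by rewrite addbb expr0.
Qed.

Lemma signed_vec_neq X s t : signed_vec X s != signed_vec X t ->
  exists2 x, x \in X & s x != t x.
Proof.
move=> ne; apply/exists_inP; apply: contraNT ne => /exists_inPn no.
apply/eqP/ffunP => x; rewrite !ffunE; case: ifP => // xX.
by have := no x xX; rewrite negbK => /eqP ->.
Qed.

(** A sign disagreement turns a term 1 into -1. On a block of four coordinates this leaves at most
    2. *)
Lemma signed_dot_lt X s t : signed_vec X s != signed_vec X t ->
  dot (signed_vec X s) (signed_vec X t) <= #|X|%:Z - 2.
Proof.
move=> /signed_vec_neq[x xX st]; rewrite signed_dot setIid (bigD1 x) //=.
have -> : s x (+) t x by move: st; case: (s x); case: (t x).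
have : \sum_(i in X | i != x) (-1) ^+ (s i (+) t i) <= \sum_(i in X | i != x) (1 : int).
  by apply: ler_sum => i _; case: (s i (+) t i); rewrite ?expr1 ?expr0.
have : (#|X|%:Z = 1 + \sum_(i in X | i != x) 1)%R.
  by rewrite -[Posz _]natz -sum1_card natr_sum (bigD1 x).
move=> -> le; rewrite expr1; lra.
Qed.

Lemma signed_vec_support X s x : (signed_vec X s x != 0) = (x \in X).
Proof. by rewrite ffunE; case: ifP => //; rewrite ?eqxx // signr_eq0. Qed.

Lemma signed_vec_block X Y s t : signed_vec X s = signed_vec Y t -> X = Y.
Proof. by move=> e; apply/setP => x; rewrite -(signed_vec_support X s) e signed_vec_support. Qed.

Lemma transfer_inj : injective transfer.
Proof.
move=> v w e; apply/ffunP => -[y i].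
have e0 := congr1 (fun u : vec => u (y, ord0)) e.
have e1 := congr1 (fun u : vec => u (y, lift ord0 ord0)) e.
rewrite /= !ffunE !big_ord_recl !big_ord0 !mxE /= in e0 e1.
case: (unliftP ord0 i) => [j ->|->]; last by lra.
have -> : j = ord0 by apply: ord1.
lra.
Qed.

Lemma transferred_codeP F v :
  reflect (exists X s, X \in F /\ v = transfer (signed_vec X s)) (v \in transferred_code F).
Proof.
apply: (iffP (imfset2P _ _ _ _ _)) => [[X XF [s _ ->]]|[X [s [XF ->]]]].
  by exists X, s.
by exists X => //; exists s.
Qed.

(** Distinct vectors on one block never violate the bound. On two blocks the largest inner product
    is the size of their intersection, attained by equal signs. *)
Lemma code_condition_compatible F : (forall X, X \in F -> source_block X) ->
  code_condition (transferred_code F) = compatible F.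
Proof.
move=> sF; apply/forallP/compatibleP => [code X Y XF YF XY|cF [v vC]].
  pose s : {ffun coordinate -> bool} := [ffun=> false].
  have vC : transfer (signed_vec X s) \in transferred_code F.
    by apply/transferred_codeP; exists X, s.
  have wC : transfer (signed_vec Y s) \in transferred_code F.
    by apply/transferred_codeP; exists Y, s.
  have /forallP/(_ [` wC]%fset)/implyP := code [` vC]%fset.
  rewrite -val_eqE /= (inj_eq transfer_inj) dot_transfer signed_dot_same.
  have ne : signed_vec X s != signed_vec Y s by apply: contraNneq XY => /signed_vec_block ->.
  by move=> /(_ ne); rewrite [X in _ <= X](_ : _ = 2 * 2) // ler_pM2l.
apply/forallP => -[w wC]; apply/implyP; rewrite -val_eqE /=.
have /transferred_codeP[X [s [XF ->]]] := vC.
have /transferred_codeP[Y [t [YF ->]]] := wC.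
rewrite (inj_eq transfer_inj) dot_transfer [X in _ <= X](_ : _ = 2 * 2) // ler_pM2l //.
have [<-|XY] := eqVneq X Y.
  by move/signed_dot_lt; rewrite card_source_block ?sF.
by move=> _; rewrite (le_trans (signed_dot_le X Y s t)) // lez_nat cF.
Qed.

End Code.

Lemma card_transferred_code F : (forall X, X \in F -> source_block X) ->
  #|` transferred_code F|%fset = 16 * #|F|.
Proof.
move=> sF.
(* A vector is encoded by its block and the set of its negative entries. Taking that set inside the
   block removes the irrelevant signs and leaves 2^4 vectors per block. *)
pose f (u : {set coordinate} * {set coordinate}) : vec :=
  transfer (signed_vec u.1 [ffun x => x \in u.2]).
pose K := [set u : {set coordinate} * {set coordinate} | (u.1 \in F) && (u.2 \subset u.1)].
have injf : {in K &, injective f}.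
  move=> [X S] [Y T]; rewrite !inE /= => /andP[XF SX] /andP[YF TY] /transfer_inj e.
  have /= eXY := signed_vec_block e; subst Y; congr pair; apply/setP => x.
  have := congr1 (fun v : vec => v x) e; rewrite /= !ffunE.
  case: ifP => [xX|/negP xX _]; first by case: (x \in S); case: (x \in T).
  by apply/idP/idP => [/(subsetP SX)|/(subsetP TY)].
have -> : transferred_code F = [fset f u | u in K]%fset.
  apply/fsetP => v; apply/transferred_codeP/imfsetP => [[X [s [XF ->]]]|[[X S] /= + ->]].
    exists (X, [set x in X | s x]).
      by rewrite /= inE XF setIdE subsetIl.
    congr transfer; apply/ffunP => x; rewrite !ffunE inE.
    by case: ifP.
  by rewrite inE => /andP[XF _]; exists X, [ffun x => x \in S].
rewrite card_in_imfset //= -cardE.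
have -> : #|K| = \sum_(X in F) \sum_(S : {set coordinate} | S \subset X) 1.
  by rewrite pair_big_dep -sum1_card; apply: eq_bigl => u; rewrite inE.
rewrite (eq_bigr (fun=> 16)) ?sum_nat_const 1?mulnC // => X /sF sX.
rewrite sum1_card -(eq_card (A := powerset X)) ?card_powerset ?card_source_block //.
by move=> S; rewrite inE.
Qed.

Lemma allowed_source H F : allowed_family H F -> forall X, X \in F -> source_block X.
Proof. by move=> /allowed_familyP aF X /aF[a _ /block_of_typeP[]]. Qed.

(** Allowed families consist of source blocks, so both maxima range over the same families. *)
Lemma max_code_size_eq H : max_code_size H = 16 * beta H.
Proof.
rewrite /max_code_size /beta (big_morph (muln 16) (@maxnMr 16) (muln0 16)).
rewrite (eq_bigl (fun F => allowed_family H F && compatible F)) => [|F].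
  by apply: eq_bigr => F /andP[/allowed_source/card_transferred_code].
by have [/allowed_source/code_condition_compatible ->|] := boolP (allowed_family H F).
Qed.

Theorem theorem6p6 (H : {set edge}) :
  [/\ ((beta H)%:Z = 8 * #|H|%:Z - 4 * (matching_number (D H))%:Z)%R,
      beta H = \max_(M : {set edge} | is_matching H M)
                 (8 * #|M| + 4 * #|delete_ends H M|),
      max_code_size H = 16 * beta H,
      forall (N : {set edge * edge}) (F : {set {set coordinate}}),
        is_matching (D H) N -> #|N| = matching_number (D H) ->
        allowed_family H F -> compatible F ->
        (#|F| = beta H <->
         (forall a b : edge, (a, b) \in N ->
            type_count F a + type_count F b = 8) /\
         (forall a : edge, a \in H ->
            a \notin left_ends N \/ a \notin right_ends N ->
            type_count F a = 8))
    & exists F : {set {set coordinate}},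
        [/\ allowed_family H F, compatible F, #|F| = beta H
          & forall a : edge, a \in H -> type_count F a \in [:: 0; 4; 8]]].
Proof.
have bH := beta_eq H.
have [M mM le] := exists_optimal_matching H.
have bM : beta H = 8 * #|M| + 4 * #|delete_ends H M|.
  apply/eqP; rewrite eqn_leq; apply/andP; split.
    by rewrite -(leq_add2r (4 * matching_number (D H))) bH.
  by rewrite -card_design // leq_beta ?allowed_design ?compatible_design.
split.
- have : ((beta H + 4 * matching_number (D H))%:Z = (8 * #|H|)%:Z)%R by rewrite bH.
  by rewrite PoszD !PoszM => <-; rewrite addrK.
- apply/eqP; rewrite eqn_leq; apply/andP; split.
    rewrite bM.
    exact: (leq_bigmax_cond (F := fun M : {set edge} => 8 * #|M| + 4 * #|delete_ends H M|)).
  apply/bigmax_leqP => M' mM'.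
  by rewrite -card_design // leq_beta ?allowed_design ?compatible_design.
- exact: max_code_size_eq.
- move=> N F mN cN aF cF; have [_ e] := leqif_card_family mN aF cF.
  (* As 2 beta + 8 nu = 16 h, optimality is equality in [leqif_card_family]. *)
  have -> : #|F| = beta H <-> (2 * #|F| + 8 * #|N| == 16 * #|H|).
    rewrite cN (_ : 16 = 2 * 8) // -[2 * 8 * _]mulnA -bH mulnDr mulnA eqn_add2r eqn_pmul2l //.
    by split=> /eqP.
  rewrite e; split=> [/and3P[/forall_inP hN /forall_inP hl /forall_inP hr]|[hN hU]].
    split=> [a b abN|a aH [al|ar]]; apply/eqP; first exact: (hN (a, b)).
      by apply: hl; rewrite inE al.
    by apply: hr; rewrite inE ar.
  apply/and3P; split; apply/forall_inP; first by case=> a b /hN ->.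
    move=> a. rewrite inE => /andP[al aH]; by rewrite hU //; left.
  move=> a; rewrite inE => /andP[ar aH]; by rewrite hU //; right.
(* Its counts are 8 on [M], 4 on E(H - V(M)) and 0 elsewhere. *)
- exists (design H M); split; [exact: allowed_design|exact: compatible_design| |].
    by rewrite card_design.
  move=> a aH; rewrite type_count_design //.
  have [aM|_] := boolP (a \in M); last by case: (_ \in delete_ends H M).
  have aL : a.1 \in left_ends M by apply: imset_f.
  by rewrite [a \in delete_ends H M]inE aL andbF.
Qed.
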